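(* Let $m\ge n\ge 1$ be integers, let $X\in\mathbb{R}^{m\times n}$ have $\mathrm{rank}(X)=n$, and put $\mathbf{u}=2^{-53}$. Let $k$ be the number of non-zero entries of $X$, $c=\max_{i,j}|x_{ij}|$ and $l=\frac{c\sqrt{k}}{\|X\|_2}$. Assume $$mn\mathbf{u}\le\tfrac1{64},\qquad n(n+1)\mathbf{u}\le\tfrac1{64},\qquad \kappa_2(X)\le\frac{1}{85\,l\sqrt{n}\,(m\mathbf{u}+(n+1)\mathbf{u})},$$ and let $s=11(m\mathbf{u}+(n+1)\mathbf{u})\,kc^2$, with $s\le\frac{1}{100n}kc^2$. Let $[Q,R]=\mathrm{SCholeskyQR3}(X)$ be computed in floating-point arithmetic with shift $s$. Then $$\|Q^\top Q-I\|_F\le 6\big(mn\mathbf{u}+n(n+1)\mathbf{u}\big),$$ $$\|QR-X\|_F\le\big(3.58\,l+5.45\sqrt{n}\big)\,n\sqrt{n}\,\mathbf{u}\,\|X\|_2 .$$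
   Context: $\|\cdot\|_2$ and $\|\cdot\|_F$ are the spectral and Frobenius norms, $\sigma_{\min}$ the smallest singular value, $\kappa_2(A)=\|A\|_2/\sigma_{\min}(A)$. $|A|$ is the entrywise absolute value and inequalities between matrices are entrywise. $\gamma_j:=\frac{j\mathbf{u}}{1-j\mathbf{u}}$, with $\gamma_j\le 1.02\,j\mathbf{u}$ for the $j$ used. SCholeskyQR3 with shift $s>0$, in exact arithmetic: first SCholeskyQR: $G=X^\top X$, $Y$ = upper triangular Cholesky factor of $G+sI$, $W=XY^{-1}$; then CholeskyQR2 on $W$: $C=W^\top W$, $D=\mathrm{Cholesky}(C)$, $V=WD^{-1}$, $B=V^\top V$, $J=\mathrm{Cholesky}(B)$, $Q=VJ^{-1}$; finally $R=J(DY)$. ''Computed in floating-point arithmetic'' means that the computed matrices obey the standard rounding error model (Cholesky factorizations running to completion, triangular factors $Y,D,J$ upper triangular and non-singular). Lower-case letters with index $i$ denote the $i$-th rows. - $G=X^\top X+E_A$, $|E_A|\le\gamma_m|X|^\top|X|$; $Y^\top Y=G+sI+E_B$, $|E_B|\le\gamma_{n+1}|Y^\top||Y|$; $w_i^\top=x_i^\top(Y+\Delta Y_i)^{-1}$, $|\Delta Y_i|\le\gamma_n|Y|$. - $C=W^\top W+E_1$, $|E_1|\le\gamma_m|W|^\top|W|$; $D^\top D=C+E_2$, $|E_2|\le\gamma_{n+1}|D^\top||D|$; $v_i^\top=w_i^\top(D+\Delta D_i)^{-1}$, $|\Delta D_i|\le\gamma_n|D|$. - $B=V^\top V+E_5$,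 $|E_5|\le\gamma_m|V|^\top|V|$; $J^\top J=B+E_6$, $|E_6|\le\gamma_{n+1}|J^\top||J|$; $q_i^\top=v_i^\top(J+\Delta J_i)^{-1}$, $|\Delta J_i|\le\gamma_n|J|$. - The factor $R$ is formed in two multiplications: $N$ with $|DY-N|\le\gamma_n|D||Y|$, then $R$ with $|JN-R|\le\gamma_n|J||N|$. *)

(* Defs.v *)
From HB Require Import structures.
From mathcomp Require Import all_boot all_order all_algebra.
From mathcomp Require Import classical_sets reals.

Set Implicit Arguments.
Unset Strict Implicit.
Unset Printing Implicit Defensive.

Import Order.TTheory GRing.Theory Num.Theory.
Local Open Scope classical_set_scope.
Local Open Scope ring_scope.

(* On column vectors this is the Euclidean norm. *)
Definition fnorm (R : realType) (m n : nat) (A : 'M[R]_(m, n)) : R :=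
  Num.sqrt (\sum_i \sum_j A i j ^+ 2).

(* The matrix norm induced by the Euclidean vector norm (for 0 < n). *)
Definition specnorm (R : realType) (m n : nat) (A : 'M[R]_(m, n)) : R :=
  sup [set fnorm (A *m x) | x in [set x : 'cV[R]_n | fnorm x = 1]].

(* For n <= m, these are exactly the singular values of A; for m < n the value
   0 would be included as well. *)
Definition singular_values (R : realType) (m n : nat) (A : 'M[R]_(m, n)) :
    set R :=
  [set t | 0 <= t /\ eigenvalue (A^T *m A) (t ^+ 2)].

(* A minimum when 0 < n, since the set is then finite and nonempty. *)
Definition sigma_min (R : realType) (m n : nat) (A : 'M[R]_(m, n)) : R :=
  inf (singular_values A).

Definition kappa2 (R : realType) (m n : nat) (A : 'M[R]_(m, n)) : R :=
  specnorm A / sigma_min A.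

Definition absmx (R : realType) (m n : nat) (A : 'M[R]_(m, n)) : 'M[R]_(m, n) :=
  map_mx (fun x => `|x|) A.

Definition lemx (R : realType) (m n : nat) (A B : 'M[R]_(m, n)) : Prop :=
  forall i j, A i j <= B i j.

Definition nnz (R : realType) (m n : nat) (A : 'M[R]_(m, n)) : nat :=
  #|[pred ij : 'I_m * 'I_n | A ij.1 ij.2 != 0]|.

Definition maxabs (R : realType) (m n : nat) (A : 'M[R]_(m, n)) : R :=
  \big[Num.max/0]_(ij : 'I_m * 'I_n) `|A ij.1 ij.2|.

Definition gamma (R : realType) (u : R) (j : nat) : R :=
  (j%:R * u) / (1 - j%:R * u).

(* MathComp's is_trig_mx is lower triangularity. *)
Definition upper_trig (R : realType) (n : nat) (A : 'M[R]_n) : bool :=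
  is_trig_mx A^T.

(* The predicates fl_* are the rounding error model with unit roundoff u; the
   result of the floating-point operation is the last argument (the last two
   for a QR step). *)

Definition fl_gram (R : realType) (u : R) (m n : nat)
    (A : 'M[R]_(m, n)) (G : 'M[R]_n) : Prop :=
  exists E : 'M[R]_n,
    G = A^T *m A + E /\ lemx (absmx E) (gamma u m *: ((absmx A)^T *m absmx A)).

Definition fl_cholesky (R : realType) (u : R) (n : nat) (A Y : 'M[R]_n) : Prop :=
  [/\ upper_trig Y, Y \in unitmx &
      exists E : 'M[R]_n,
        Y^T *m Y = A + E /\
        lemx (absmx E) (gamma u n.+1 *: (absmx Y^T *m absmx Y))].

(* Row-wise solution of W Y = A.  The perturbation is allowed to depend on the
   row.  Since invmx is the identity on singular matrices, invertibility of the
   perturbed factor is required explicitly. *)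
Definition fl_solve (R : realType) (u : R) (m n : nat)
    (A : 'M[R]_(m, n)) (Y : 'M[R]_n) (W : 'M[R]_(m, n)) : Prop :=
  forall i : 'I_m, exists dY : 'M[R]_n,
    [/\ lemx (absmx dY) (gamma u n *: absmx Y), Y + dY \in unitmx &
        row i W = row i A *m invmx (Y + dY)].

Definition fl_mul (R : realType) (u : R) (n : nat) (A B N : 'M[R]_n) : Prop :=
  lemx (absmx (A *m B - N)) (gamma u n *: (absmx A *m absmx B)).

(* CholeskyQR with shift s; s = 0 is the unshifted algorithm. *)
Definition fl_SCholeskyQR (R : realType) (u s : R) (m n : nat)
    (A W : 'M[R]_(m, n)) (Y : 'M[R]_n) : Prop :=
  exists G : 'M[R]_n,
    [/\ fl_gram u A G, fl_cholesky u (G + s%:M) Y & fl_solve u A Y W].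

Definition fl_SCholeskyQR3 (R : realType) (u s : R) (m n : nat)
    (X Q : 'M[R]_(m, n)) (Rf : 'M[R]_n) : Prop :=
  exists (W V : 'M[R]_(m, n)) (Y D J N : 'M[R]_n),
    [/\ fl_SCholeskyQR u s X W Y,
        fl_SCholeskyQR u 0 W V D,
        fl_SCholeskyQR u 0 V Q J,
        fl_mul u D Y N &
        fl_mul u J N Rf].

(* Main.v *)
(* Write eps = m u + (n+1) u, K = c sqrt k (so |X|_F <= K) and t = sqrt (n eps);
   the size condition on s forces t <= 1/33, and the condition number bound says
   that sigma_min(X) >= 85 sqrt n eps K.  The Gram and Cholesky errors of the
   shifted step are about s/10, so the quadratic form |Yz|^2 lies between
   |Xz|^2 + 0.9 s |z|^2 and |Xz|^2 + 1.1 s |z|^2; hence the singular values of W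
   lie in [18 t, 1.01].  The errors of the second step are about t^2, far below
   (18 t)^2, so V has singular values within 2% of 1, and the third step
   then gives |Q^T Q - I|_F <= 3 t^2.  The residual telescopes into the backward
   errors of the three triangular solves and of the two products. *)

Require Import Defs.
From HB Require Import structures.
From mathcomp Require Import all_boot all_order all_algebra.
From mathcomp Require Import classical_sets reals.
From mathcomp Require Import ring lra.

Set Implicit Arguments.
Unset Strict Implicit.
Unset Printing Implicit Defensive.

Import Order.TTheory GRing.Theory Num.Theory.
Local Open Scope ring_scope.

(** * Cauchy-Schwarz and the Frobenius norm *)

Lemma CauchySchwarz_sum (R : realFieldType) (I : finType) (f g : I -> R) :
  (\sum_i f i * g i) ^+ 2 <= (\sum_i f i ^+ 2) * (\sum_i g i ^+ 2).
Proof.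
set p := \sum_i f i * g i; set a := \sum_i f i ^+ 2; set b := \sum_i g i ^+ 2.
have a0 : 0 <= a by apply: sumr_ge0 => i _; exact: sqr_ge0.
(* This quadratic in [x] is a sum of squares; for nonzero [a] its value at the minimiser [p / a] is
   [b - p^2 / a]. *)
have quad x : 0 <= x ^+ 2 * a - 2 * x * p + b.
  have -> : x ^+ 2 * a - 2 * x * p + b = \sum_i (x * f i - g i) ^+ 2.
    rewrite /a /p /b !mulr_sumr -sumrN -!big_split /=.
    by apply: eq_bigr => i _; ring.
  by apply: sumr_ge0 => i _; exact: sqr_ge0.
have [a00|an0] := eqVneq a 0.
  have fE i : f i = 0.
    apply/eqP; rewrite -sqrf_eq0.
    move/eqP: a00; rewrite psumr_eq0; last by move=> j _; exact: sqr_ge0.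
    by move=> /allP /(_ i); rewrite mem_index_enum => /(_ isT).
  have -> : p = 0 by rewrite /p big1 // => i _; rewrite fE mul0r.
  by rewrite expr0n a00 mul0r.
have := quad (p / a).
have -> : (p / a) ^+ 2 * a - 2 * (p / a) * p + b = b - p ^+ 2 / a by field.
by rewrite subr_ge0 ler_pdivrMr ?lt_def ?an0 // mulrC.
Qed.

Lemma fnorm_ge0 (R : realType) m n (A : 'M[R]_(m, n)) : 0 <= fnorm A.
Proof. exact: sqrtr_ge0. Qed.

Lemma fnorm_sqr (R : realType) m n (A : 'M[R]_(m, n)) :
  fnorm A ^+ 2 = \sum_i \sum_j A i j ^+ 2.
Proof.
rewrite sqr_sqrtr //; apply: sumr_ge0 => i _.
by apply: sumr_ge0 => j _; exact: sqr_ge0.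
Qed.

Lemma fnorm_sqr_tr (R : realType) m n (A : 'M[R]_(m, n)) :
  fnorm A ^+ 2 = \tr (A^T *m A).
Proof.
rewrite fnorm_sqr exchange_big /=; apply: eq_bigr => j _.
by rewrite mxE; apply: eq_bigr => i _; rewrite mxE expr2.
Qed.

Lemma fnormT (R : realType) m n (A : 'M[R]_(m, n)) : fnorm A^T = fnorm A.
Proof.
rewrite /fnorm exchange_big; congr Num.sqrt.
by apply: eq_bigr => i _; apply: eq_bigr => j _; rewrite mxE.
Qed.

Lemma fnormN (R : realType) m n (A : 'M[R]_(m, n)) : fnorm (- A) = fnorm A.
Proof.
congr Num.sqrt; apply: eq_bigr => i _; apply: eq_bigr => j _.
by rewrite mxE sqrrN.
Qed.

Lemma fnorm_sqr_le (R : realType) m n (A : 'M[R]_(m, n)) a :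
  0 <= a -> fnorm A ^+ 2 <= a ^+ 2 -> fnorm A <= a.
Proof. by move=> a0; rewrite ler_pXn2r // nnegrE fnorm_ge0. Qed.

Lemma fnorm_absmx (R : realType) m n (A : 'M[R]_(m, n)) :
  fnorm (absmx A) = fnorm A.
Proof.
congr Num.sqrt; apply: eq_bigr => i _; apply: eq_bigr => j _.
by rewrite mxE real_normK // num_real.
Qed.

Lemma fnormZ (R : realType) m n a (A : 'M[R]_(m, n)) :
  0 <= a -> fnorm (a *: A) = a * fnorm A.
Proof.
move=> a0; rewrite -{2}(ger0_norm a0) -sqrtr_sqr -sqrtrM ?sqr_ge0 //.
congr Num.sqrt; rewrite mulr_sumr; apply: eq_bigr => i _.
by rewrite mulr_sumr; apply: eq_bigr => j _; rewrite mxE exprMn.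
Qed.

Lemma fnorm_lemx (R : realType) m n (A B : 'M[R]_(m, n)) :
  lemx (absmx A) B -> fnorm A <= fnorm B.
Proof.
move=> AB; rewrite -fnorm_absmx; apply: ler_wsqrtr.
apply: ler_sum => i _; apply: ler_sum => j _.
by rewrite ler_pXn2r ?AB // nnegrE ?(le_trans _ (AB i j)) // mxE.
Qed.

Lemma mxtrace_mul_le_fnorm (R : realType) m n (A B : 'M[R]_(m, n)) :
  `|\tr (A^T *m B)| <= fnorm A * fnorm B.
Proof.
rewrite -(@ler_pXn2r _ 2) ?nnegrE ?mulr_ge0 ?fnorm_ge0 //.
rewrite real_normK ?num_real // exprMn !fnorm_sqr !pair_big /=.
apply: le_trans (CauchySchwarz_sum _ _); rewrite le_eqVlt; apply/orP; left.
apply/eqP; congr (_ ^+ 2).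
rewrite -(pair_big xpredT xpredT (fun i j => A i j * B i j)) /=.
rewrite exchange_big; apply: eq_bigr => j _.
by rewrite mxE; apply: eq_bigr => i _; rewrite mxE.
Qed.

Lemma fnorm_sqrD (R : realType) m n (A B : 'M[R]_(m, n)) :
  fnorm (A + B) ^+ 2 = fnorm A ^+ 2 + 2 * \tr (A^T *m B) + fnorm B ^+ 2.
Proof.
rewrite !fnorm_sqr_tr [(A + B)^T]linearD /= mulmxDl !mulmxDr !mxtraceD.
have -> : \tr (B^T *m A) = \tr (A^T *m B).
  by rewrite -mxtrace_tr trmx_mul trmxK.
by ring.
Qed.

Lemma fnormD (R : realType) m n (A B : 'M[R]_(m, n)) :
  fnorm (A + B) <= fnorm A + fnorm B.
Proof.
apply: fnorm_sqr_le; first by rewrite addr_ge0 ?fnorm_ge0.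
have := le_trans (ler_norm _) (mxtrace_mul_le_fnorm A B).
by rewrite fnorm_sqrD sqrrD; lra.
Qed.

Lemma fnormB (R : realType) m n (A B : 'M[R]_(m, n)) :
  fnorm (A - B) <= fnorm A + fnorm B.
Proof. by rewrite -(fnormN B) fnormD. Qed.

Lemma fnormM (R : realType) m n p (A : 'M[R]_(m, n)) (B : 'M_(n, p)) :
  fnorm (A *m B) <= fnorm A * fnorm B.
Proof.
apply: fnorm_sqr_le; first by rewrite mulr_ge0 ?fnorm_ge0.
rewrite exprMn !fnorm_sqr mulr_suml; apply: ler_sum => i _.
rewrite exchange_big /= mulr_sumr; apply: ler_sum => j _.
by rewrite mxE; exact: CauchySchwarz_sum.
Qed.

Lemma fnorm_eq0 (R : realType) m n (A : 'M[R]_(m, n)) :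
  (fnorm A == 0) = (A == 0).
Proof.
apply/idP/eqP => [|->]; last first.
  rewrite /fnorm big1 ?sqrtr0 // => i _; rewrite big1 // => j _.
  by rewrite mxE expr0n.
rewrite -sqrf_eq0 fnorm_sqr psumr_eq0 => [/allP A0|i _]; last first.
  by apply: sumr_ge0 => j _; exact: sqr_ge0.
apply/matrixP => i j; rewrite mxE; apply/eqP.
have := A0 i; rewrite mem_index_enum => /(_ isT) /=.
rewrite psumr_eq0 => [/allP /(_ j)|k _]; last exact: sqr_ge0.
by rewrite mem_index_enum sqrf_eq0 => /(_ isT).
Qed.

Lemma fnorm1 (R : realType) n : fnorm (1%:M : 'M[R]_n) = Num.sqrt n%:R.
Proof.
apply/eqP; rewrite -(@eqrXn2 _ 2) ?fnorm_ge0 ?sqrtr_ge0 //.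
by rewrite fnorm_sqr_tr trmx1 mulmx1 mxtrace1 sqr_sqrtr.
Qed.

(** * Bounds on the operator norm *)

(** An upper bound on the spectral norm as a predicate, which composes under products and
    differences without handling suprema. *)
Definition opbound (R : realType) m n (A : 'M[R]_(m, n)) (a : R) :=
  forall z : 'cV[R]_n, fnorm (A *m z) <= a * fnorm z.

Lemma opbound_fnorm (R : realType) m n (A : 'M[R]_(m, n)) : opbound A (fnorm A).
Proof. by move=> z; exact: fnormM. Qed.

Lemma opbound_le (R : realType) m n (A : 'M[R]_(m, n)) a b :
  a <= b -> opbound A a -> opbound A b.
Proof.
by move=> ab Aa z; apply: le_trans (Aa z) _; rewrite ler_wpM2r ?fnorm_ge0.
Qed.

Lemma opboundB (R : realType) m n (A B : 'M[R]_(m, n)) a b :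
  opbound A a -> opbound B b -> opbound (A - B) (a + b).
Proof.
move=> Aa Bb z; rewrite mulmxBl mulrDl.
by apply: le_trans (fnormB _ _) _; apply: lerD.
Qed.

Lemma opboundM (R : realType) m n p (A : 'M[R]_(m, n)) (B : 'M_(n, p)) a b :
  0 <= a -> opbound A a -> opbound B b -> opbound (A *m B) (a * b).
Proof.
move=> a0 Aa Bb z; rewrite -mulmxA -mulrA.
by apply: le_trans (Aa _) _; apply: ler_wpM2l.
Qed.

(** The squared Frobenius norm is the sum of the squared column norms, and each column of [A *m B]
    is [A] applied to a column of [B]. *)
Lemma opbound_mulmx (R : realType) m n p (A : 'M[R]_(m, n)) (B : 'M_(n, p)) a :
  0 <= a -> opbound A a -> fnorm (A *m B) <= a * fnorm B.
Proof.
move=> a0 Aa; have fnorm_col q (M : 'M[R]_(q, p)) :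
    fnorm M ^+ 2 = \sum_j fnorm (col j M) ^+ 2.
  rewrite fnorm_sqr exchange_big; apply: eq_bigr => j _; rewrite fnorm_sqr.
  by apply: eq_bigr => i _; rewrite big_ord1 mxE.
apply: fnorm_sqr_le; first by rewrite mulr_ge0 ?fnorm_ge0.
rewrite exprMn !fnorm_col mulr_sumr; apply: ler_sum => j _.
rewrite -exprMn ler_pXn2r ?nnegrE ?mulr_ge0 ?fnorm_ge0 //.
by rewrite colE -mulmxA -colE.
Qed.

(** [|A^T z|^2 = <z, A A^T z> <= |z| a |A^T z|]; dividing by [|A^T z|] leaves the claim. *)
Lemma opboundT (R : realType) m n (A : 'M[R]_(m, n)) a :
  0 <= a -> opbound A a -> opbound A^T a.
Proof.
move=> a0 Aa z; set t := fnorm _.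
have [->|t0] := eqVneq t 0; first by rewrite mulr_ge0 ?fnorm_ge0.
have tp : 0 < t by rewrite lt_def t0 fnorm_ge0.
rewrite -(ler_pM2l tp) -expr2 fnorm_sqr_tr trmx_mul trmxK -mulmxA.
apply: le_trans (ler_norm _) _; apply: le_trans (mxtrace_mul_le_fnorm _ _) _.
by have := ler_wpM2l (fnorm_ge0 z) (Aa (A^T *m z)); rewrite -/t; lra.
Qed.

Lemma opbound_mulmxr (R : realType) m n p (A : 'M[R]_(m, n)) (B : 'M_(p, m)) a :
  0 <= a -> opbound A a -> fnorm (B *m A) <= fnorm B * a.
Proof.
move=> a0 /(opboundT a0) Aa.
by rewrite -fnormT trmx_mul mulrC -(fnormT B); apply: opbound_mulmx.
Qed.

Lemma fnorm_opbound (R : realType) m n (A : 'M[R]_(m, n)) a :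
  0 <= a -> opbound A a -> fnorm A <= a * Num.sqrt n%:R.
Proof. by move=> a0 Aa; rewrite -[A]mulmx1 -fnorm1; exact: opbound_mulmx. Qed.

Lemma opbound_specnorm (R : realType) m n (A : 'M[R]_(m, n)) :
  (0 < n)%N -> opbound A (specnorm A).
Proof.
move=> n0 z; have [->|z0] := eqVneq z 0.
  have /eqP -> : fnorm (0 : 'cV[R]_n) == 0 by rewrite fnorm_eq0.
  by rewrite mulmx0 mulr0 (_ : fnorm _ = 0) //; apply/eqP; rewrite fnorm_eq0.
have zp : 0 < fnorm z by rewrite lt_def fnorm_eq0 z0 fnorm_ge0.
have unit_z : fnorm ((fnorm z)^-1 *: z) = 1.
  by rewrite fnormZ ?invr_ge0 ?fnorm_ge0 // mulVf // gt_eqF.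
rewrite -ler_pdivrMr // mulrC -fnormZ ?invr_ge0 ?fnorm_ge0 // scalemxAr.
apply: sup_upper_bound; last by exists ((fnorm z)^-1 *: z).
(* [sup] takes a default value on a set that is empty or unbounded above, so both are excluded;
   [fnorm A] is an upper bound. *)
split; first by exists (fnorm (A *m ((fnorm z)^-1 *: z))), ((fnorm z)^-1 *: z).
exists (fnorm A) => _ [y /= y1 <-].
by apply: le_trans (fnormM _ _) _; rewrite y1 mulr1.
Qed.

(** * The smallest singular value *)

Lemma fnorm_mulmx_sqr (R : realType) m n (A : 'M[R]_(m, n)) (z : 'cV[R]_n) :
  fnorm (A *m z) ^+ 2 = \tr (z^T *m (A^T *m A *m z)).
Proof. by rewrite fnorm_sqr_tr trmx_mul !mulmxA. Qed.

(* If [A^T A - lam I] were invertible, Cauchy-Schwarz for this semidefinite form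
   would bound it below on the unit sphere, so [lam] could be increased. *)
Lemma min_singular_value (R : realType) m n (A : 'M[R]_(m, n)) :
  (0 < n)%N -> exists2 t, singular_values A t &
    forall z : 'cV[R]_n, t * fnorm z <= fnorm (A *m z).
Proof.
move=> n0.
pose S := [set fnorm (A *m z) ^+ 2 | z in [set z : 'cV[R]_n | fnorm z = 1]]%classic.
have lbS : lbound S 0 by move=> _ [z /= _ <-]; exact: sqr_ge0.
have Sneq0 : (S !=set0)%classic.
  pose e : 'cV[R]_n := delta_mx (Ordinal n0) 0.
  exists (fnorm (A *m e) ^+ 2), e => //=.
  apply/eqP; rewrite -(@eqrXn2 _ 2) ?fnorm_ge0 // fnorm_sqr_tr trmx_delta.
  by rewrite mul_delta_mx /mxtrace big_ord1 mxE expr1n.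
have hasS : has_lbound S by exists 0.
pose lam := inf S; have lam0 : 0 <= lam by exact: lb_le_inf.
have scale (a : R) : (forall x, S x -> a <= x) ->
    forall z : 'cV[R]_n, a * fnorm z ^+ 2 <= fnorm (A *m z) ^+ 2.
  move=> aS z; have [->|z0] := eqVneq z 0.
    have /eqP -> : fnorm (0 : 'cV[R]_n) == 0 by rewrite fnorm_eq0.
    by rewrite expr0n mulr0 sqr_ge0.
  have zp : 0 < fnorm z by rewrite lt_def fnorm_eq0 z0 fnorm_ge0.
  rewrite -ler_pdivlMr ?exprn_gt0 // -exprVn mulrC -exprMn.
  rewrite -fnormZ ?invr_ge0 ?fnorm_ge0 // scalemxAr; apply: aS.
  exists ((fnorm z)^-1 *: z) => //=.
  by rewrite fnormZ ?invr_ge0 ?fnorm_ge0 // mulVf // gt_eqF.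
have lamP := scale lam (ge_inf hasS).
exists (Num.sqrt lam); last first.
  move=> z; rewrite -(@ler_pXn2r _ 2) ?nnegrE ?mulr_ge0 ?sqrtr_ge0 ?fnorm_ge0 //.
  by rewrite exprMn sqr_sqrtr.
split; first exact: sqrtr_ge0.
rewrite sqr_sqrtr // /eigenvalue /eigenspace kermx_eq0 row_free_unit.
set M := _ - _; apply/negP => Mu.
pose mu := fnorm M; pose nu := fnorm (invmx M).
have M0 : M != 0.
  apply: contraTneq Mu => ->; rewrite unitmxE unitfE.
  by rewrite -(prednK n0) det0 eqxx.
have mu0 : 0 < mu by rewrite lt_def fnorm_eq0 M0 fnorm_ge0.
have nu0 : 0 < nu.
  rewrite lt_def fnorm_ge0 fnorm_eq0 andbT.
  by apply: contraNneq M0 => iM; rewrite -[M]mulmx1 -(mulmxV Mu) iM !mulmx0.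
have MT : M^T = M by rewrite linearB /= trmx_mul trmxK tr_scalar_mx.
have qE (z : 'cV[R]_n) :
    \tr (z^T *m (M *m z)) = fnorm (A *m z) ^+ 2 - lam * fnorm z ^+ 2.
  rewrite fnorm_mulmx_sqr mulmxBl mulmxBr linearB /= mul_scalar_mx -scalemxAr.
  by rewrite linearZ /= -fnorm_sqr_tr.
(* With [w = M z] and [t = 1 / mu], nonnegativity of the form at [z - t w] gives
   [z^T w >= 2 t |w|^2 - t^2 w^T M w], and [w^T M w <= mu |w|^2] makes the right-hand side at least
   [|w|^2 / mu]. *)
have q_ge (z : 'cV[R]_n) : fnorm (M *m z) ^+ 2 / mu <= \tr (z^T *m (M *m z)).
  set w := M *m z; set t := mu^-1.
  have : 0 <= \tr ((z - t *: w)^T *m (M *m (z - t *: w))).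
    by rewrite qE subr_ge0.
  have -> : \tr ((z - t *: w)^T *m (M *m (z - t *: w))) =
      \tr (z^T *m w) - 2 * t * fnorm w ^+ 2 + t ^+ 2 * \tr (w^T *m (M *m w)).
    have zw : \tr (z^T *m (M *m w)) = \tr (w^T *m w).
      by rewrite mulmxA -{1}MT -trmx_mul.
    rewrite fnorm_sqr_tr (mulmxBr M) -scalemxAr -/w.
    rewrite [(z - _)^T]linearB /= [(t *: w)^T]linearZ /=.
    rewrite mulmxBl (mulmxBr z^T) (mulmxBr (t *: w^T)).
    rewrite -!scalemxAl -!scalemxAr !raddfB /= !mxtraceZ zw.
    by ring.
  have : \tr (w^T *m (M *m w)) <= mu * fnorm w ^+ 2.
    apply: le_trans (ler_norm _) _.
    apply: le_trans (mxtrace_mul_le_fnorm _ _) _.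
    by rewrite expr2 mulrCA ler_wpM2l ?fnorm_ge0 ?fnormM.
  move/(ler_wpM2l (sqr_ge0 t)); rewrite {2}/t.
  have -> : t ^+ 2 * (mu * fnorm w ^+ 2) = t * fnorm w ^+ 2.
    by rewrite /t; field; rewrite gt_eqF.
  by rewrite -/t [_ ^+ 2 * t]mulrC; lra.
(* On the unit sphere [|M z| >= 1 / nu], so [|A z|^2] exceeds [lam] by at least [1 / (mu nu^2)],
   although [lam] is its infimum there. *)
have : lam + (mu * nu ^+ 2)^-1 <= lam.
  apply: lb_le_inf => // _ [z /= z1 <-].
  have := q_ge z; rewrite qE z1 expr1n mulr1.
  suff : (mu * nu ^+ 2)^-1 <= fnorm (M *m z) ^+ 2 / mu by lra.
  rewrite invfM mulrC ler_pM2r ?invr_gt0 // -exprVn.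
  rewrite ler_pXn2r ?nnegrE ?invr_ge0 ?fnorm_ge0 //.
  rewrite -[leLHS]mul1r ler_pdivrMr // mulrC -z1 -{1}(mulKmx Mu z).
  exact: fnormM.
have : 0 < (mu * nu ^+ 2)^-1 by rewrite invr_gt0 mulr_gt0 ?exprn_gt0.
by lra.
Qed.

Lemma sigma_min_le (R : realType) m n (A : 'M[R]_(m, n)) (z : 'cV[R]_n) :
  (0 < n)%N -> sigma_min A * fnorm z <= fnorm (A *m z).
Proof.
move=> /(min_singular_value A) [t At tP]; apply: le_trans (tP z).
rewrite ler_wpM2r ?fnorm_ge0 //; apply: ge_inf => //.
by exists 0 => y [].
Qed.

(** Full column rank gives a left inverse [B]. If [A^T A] has eigenvalue [t^2] with eigenvector [v],
    then [|A v| = t |v|] and [v = B A v], so every singular value is at least [1 / |B|]. *)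
Lemma sigma_min_gt0 (R : realType) m n (A : 'M[R]_(m, n)) :
  (0 < n)%N -> \rank A = n -> 0 < sigma_min A.
Proof.
move=> n0 rA; have /row_fullP[B BA] : row_full A by rewrite /row_full rA.
have B0 : 0 < fnorm B.
  rewrite lt_def fnorm_ge0 fnorm_eq0 andbT.
  apply: contra_eq_neq BA => ->; rewrite mul0mx eq_sym -fnorm_eq0 fnorm1.
  by rewrite sqrtr_eq0 -ltNge ltr0n.
have [t At _] := min_singular_value A n0.
apply: (@lt_le_trans _ _ (fnorm B)^-1); first by rewrite invr_gt0.
apply: lb_le_inf; first by exists t.
move=> {t At} t [t0 /eigenvalueP[v vA v0]].
have vp : 0 < fnorm v^T.
  by rewrite lt_def fnorm_ge0 fnormT fnorm_eq0 v0.
have AvE : fnorm (A *m v^T) = t * fnorm v^T.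
  apply/eqP; rewrite -(@eqrXn2 _ 2) ?mulr_ge0 ?fnorm_ge0 //.
  rewrite fnorm_mulmx_sqr trmxK mulmxA vA -scalemxAl linearZ /= exprMn.
  by rewrite fnorm_sqr_tr trmxK.
rewrite -[leLHS]mul1r ler_pdivrMr // -(ler_pM2r vp) mul1r mulrAC -AvE mulrC.
by rewrite -{1}[v^T]mul1mx -BA -mulmxA fnormM.
Qed.

(** * Consequences of the rounding error model *)

(** The trace is bounded directly from the diagonal entries: passing through [fnorm E] would cost a
    factor [sqrt n]. It serves to bound the norm of a computed Cholesky factor. *)
Lemma abs_gram_bound (R : realType) m n (A : 'M[R]_(m, n)) (E : 'M[R]_n) g :
    0 <= g -> lemx (absmx E) (g *: ((absmx A)^T *m absmx A)) ->
  fnorm E <= g * fnorm A ^+ 2 /\ `|\tr E| <= g * fnorm A ^+ 2.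
Proof.
move=> g0 EA; split.
  apply: le_trans (fnorm_lemx EA) _; rewrite fnormZ // ler_wpM2l //.
  by apply: le_trans (fnormM _ _) _; rewrite fnormT fnorm_absmx expr2.
rewrite -fnorm_absmx fnorm_sqr_tr -mxtraceZ.
apply: le_trans (ler_norm_sum _ _ _) _; apply: ler_sum => i _.
by have := EA i i; rewrite mxE.
Qed.

(** Row [i] of the residual is [w_i dY_i]. Although [dY_i] changes with the row, all of them share
    one entrywise bound, so the residual is at most [gamma u n *: (absmx W *m absmx Y)]
    entrywise. *)
Lemma fl_solve_bound (R : realType) (u : R) m n (A W : 'M[R]_(m, n)) Y :
    0 <= gamma u n -> fl_solve u A Y W ->
  fnorm (A - W *m Y) <= gamma u n * fnorm W * fnorm Y.
Proof.
move=> g0 AYW; rewrite -mulrA.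
suff /fnorm_lemx/le_trans : lemx (absmx (A - W *m Y))
    (gamma u n *: (absmx W *m absmx Y)).
  apply; rewrite fnormZ // ler_wpM2l //.
  by rewrite -(fnorm_absmx W) -(fnorm_absmx Y) fnormM.
move=> i j; have [dY [dYY Yu rowW]] := AYW i.
have /matrixP/(_ 0 j) : row i (A - W *m Y) = row i W *m dY.
  rewrite linearB /= row_mul -[row i A](mulmxKV Yu) -rowW mulmxDr.
  by rewrite addrC addKr.
rewrite !mxE => ->; rewrite mulr_sumr; apply: le_trans (ler_norm_sum _ _ _) _.
apply: ler_sum => k _; rewrite !mxE normrM mulrCA ler_wpM2l //.
by have := dYY k j; rewrite !mxE.
Qed.

Lemma fl_mul_bound (R : realType) (u : R) n (A B N : 'M[R]_n) :
  0 <= gamma u n -> fl_mul u A B N ->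
  fnorm (A *m B - N) <= gamma u n * fnorm A * fnorm B.
Proof.
move=> g0 /fnorm_lemx/le_trans; rewrite -mulrA; apply.
by rewrite fnormZ // ler_wpM2l // -(fnorm_absmx A) -(fnorm_absmx B) fnormM.
Qed.

(** [E] collects the Gram and the Cholesky error. The bound on [fnorm Y] comes from the trace of the
    identity for [Y^T Y], with the Cholesky error, proportional to [|Y|^2], moved to the left. *)
Lemma fl_SCholeskyQR_bounds (R : realType) (u s : R) m n
    (A W : 'M[R]_(m, n)) Y :
    0 <= gamma u m -> 0 <= gamma u n -> 0 <= gamma u n.+1 ->
    fl_SCholeskyQR u s A W Y ->
  exists2 E : 'M[R]_n, Y^T *m Y = A^T *m A + s%:M + E &
  [/\ Y \in unitmx,
      fnorm E <= gamma u m * fnorm A ^+ 2 + gamma u n.+1 * fnorm Y ^+ 2,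
      (1 - gamma u n.+1) * fnorm Y ^+ 2
        <= (1 + gamma u m) * fnorm A ^+ 2 + s * n%:R &
      fnorm (A - W *m Y) <= gamma u n * fnorm W * fnorm Y].
Proof.
move=> gm gn gn1 [_ [[EA [-> hEA]] [_ Yu [EB [YY hEB]]] hW]].
have [EA1 EA2] := abs_gram_bound gm hEA.
have [EB1 EB2] : fnorm EB <= gamma u n.+1 * fnorm Y ^+ 2 /\
    `|\tr EB| <= gamma u n.+1 * fnorm Y ^+ 2.
  by apply: abs_gram_bound => //; rewrite map_trmx.
exists (EA + EB).
  by rewrite YY -!addrA; congr (_ + _); rewrite addrCA.
split=> //.
- by apply: le_trans (fnormD _ _) _; apply: lerD.
- have := congr1 mxtrace YY; rewrite !linearD /= mxtrace_scalar -!fnorm_sqr_tr.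
  rewrite -mulr_natr.
  by move: (le_trans (ler_norm _) EA2) (le_trans (ler_norm _) EB2); lra.
- exact: fl_solve_bound.
Qed.

(** * Perturbed Gram forms and triangular solves *)

Lemma gram_perturbation (R : realType) m n (A : 'M[R]_(m, n)) (Y E : 'M[R]_n) s :
    Y^T *m Y = A^T *m A + s%:M + E ->
  forall z : 'cV[R]_n,
    `|fnorm (Y *m z) ^+ 2 - fnorm (A *m z) ^+ 2 - s * fnorm z ^+ 2|
      <= fnorm E * fnorm z ^+ 2.
Proof.
move=> YY z; rewrite !fnorm_mulmx_sqr YY !mulmxDl !mulmxDr !linearD /=.
rewrite mul_scalar_mx -scalemxAr linearZ /= -fnorm_sqr_tr.
rewrite [X in `|X|](_ : _ = \tr (z^T *m (E *m z))); last by ring.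
apply: le_trans (mxtrace_mul_le_fnorm _ _) _.
by rewrite expr2 mulrCA ler_wpM2l ?fnorm_ge0 ?fnormM.
Qed.

Lemma ler_of_sqr (R : realDomainType) (x y : R) :
  0 <= y -> x ^+ 2 <= y ^+ 2 -> x <= y.
Proof.
move=> y0 xy; apply: le_trans (ler_norm x) _.
by rewrite -(@ler_pXn2r _ 2) ?nnegrE // real_normK // num_real.
Qed.

(* [W] is the exact [A Y^-1] up to the relative error [b]; the bound on [W] in
   terms of itself is solved using the Frobenius norm. *)
Lemma triangular_solve_bounds (R : realType) m n (A W : 'M[R]_(m, n)) (Y : 'M_n)
    (lo hi y g b : R) :
    Y \in unitmx -> 0 <= hi -> 0 <= y ->
    (forall z : 'cV_n, lo * fnorm (Y *m z) <= fnorm (A *m z)) ->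
    (forall z : 'cV_n, fnorm (A *m z) <= hi * fnorm (Y *m z)) ->
    (forall z : 'cV_n, fnorm z <= y * fnorm (Y *m z)) ->
    fnorm (A - W *m Y) <= g * fnorm W * fnorm Y -> g * fnorm Y * y <= b ->
  [/\ fnorm ((A - W *m Y) *m invmx Y) <= b * fnorm W,
      opbound (A *m invmx Y) hi /\ opbound (invmx Y) y,
      (1 - b) * fnorm W <= hi * Num.sqrt n%:R, opbound W (hi + b * fnorm W) &
      forall z : 'cV_n, (lo - b * fnorm W) * fnorm z <= fnorm (W *m z)].
Proof.
move=> Yu hi0 y0 loP hiP yP FP bP; set H := _ *m invmx Y.
(* [H] is the residual multiplied by [Y^-1]; the bounds of [A Y^-1] pass to [W] with a loss of
   [|H| <= b |W|]. *)
have WE : W = A *m invmx Y - H by rewrite /H mulmxBl (mulmxK Yu) subKr.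
have Yi : opbound (invmx Y) y.
  by move=> z; have := yP (invmx Y *m z); rewrite mulmxA mulmxV // mul1mx.
have Phi : opbound (A *m invmx Y) hi.
  by move=> z; have := hiP (invmx Y *m z); rewrite !mulmxA mulmxV // mul1mx.
have Hb : fnorm H <= b * fnorm W.
  apply: le_trans (opbound_mulmxr _ y0 Yi) _.
  apply: (@le_trans _ _ (g * fnorm W * fnorm Y * y)); first by rewrite ler_wpM2r.
  by have := ler_wpM2r (fnorm_ge0 W) bP; lra.
split=> //.
- have := fnorm_opbound hi0 Phi; have := fnormB (A *m invmx Y) H.
  by rewrite -WE; lra.
- rewrite {1}WE; apply: opbound_le _ (opboundB Phi (opbound_fnorm H)).
  by rewrite lerD2l; exact: Hb.
- move=> z; have := loP (invmx Y *m z).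
  rewrite !mulmxA mulmxV // mul1mx => loz.
  have : fnorm (A *m invmx Y *m z) <= fnorm (W *m z) + fnorm (H *m z).
    apply: le_trans (fnormD _ _).
    by rewrite -mulmxDl {1}WE subrK.
  have := fnormM H z; have := ler_wpM2r (fnorm_ge0 z) Hb.
  by lra.
Qed.

(** * Size of the roundoff parameters *)

Definition roundoff (R : realType) (u : R) (m n : nat) : R :=
  m%:R * u + n.+1%:R * u.

(** The last condition is the size condition on the shift: with [s = 11 eps K^2],
    [s <= K^2 / (100 n)] reads [n eps <= 1 / 1100]. *)
Definition small_roundoff (R : realType) (u : R) (m n : nat) : Prop :=
  [/\ 0 < u, (0 < n)%N, (n <= m)%N & n%:R * roundoff u m n <= 1 / 1100].

Lemma gamma_bounds (R : realType) (u : R) j :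
  0 <= u -> j%:R * u <= 1 / 200 ->
  0 <= gamma u j /\ gamma u j <= 101 / 100 * (j%:R * u).
Proof.
move=> u0 ju; have ju0 : 0 <= j%:R * u by rewrite mulr_ge0.
split; first by rewrite divr_ge0 //; lra.
by rewrite ler_pdivrMr; [nra | lra].
Qed.

(** [2 n u <= eps] follows from [n <= m]; through it the solve error [gamma u n] is at most about
    [eps / 2]. *)
Lemma small_roundoff_bounds (R : realType) (u : R) m n :
    small_roundoff u m n ->
  [/\ 0 < roundoff u m n, roundoff u m n <= 1 / 500,
      2 * (n%:R * u) <= roundoff u m n, 0 <= m%:R * u & 0 <= n.+1%:R * u].
Proof.
move=> [u0 n0 nm nr]; rewrite /roundoff in nr *.
have n1 : 1 <= n%:R :> R by rewrite ler1n.
have nmR : n%:R <= m%:R :> R by rewrite ler_nat.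
have nu : n%:R * u <= m%:R * u by rewrite ler_pM2r.
have nu0 : 0 < n%:R * u by rewrite mulr_gt0 // ltr0n.
have n1u : n.+1%:R * u = n%:R * u + u by rewrite -natr1 mulrDl mul1r.
split; rewrite ?n1u in nr *; try lra.
by nra.
Qed.

Lemma small_roundoff_gamma (R : realType) (u : R) m n :
    small_roundoff u m n ->
  [/\ 0 <= gamma u m /\ gamma u m <= 101 / 100 * (m%:R * u),
      0 <= gamma u n.+1 /\ gamma u n.+1 <= 101 / 100 * (n.+1%:R * u) &
      0 <= gamma u n /\ gamma u n <= 101 / 100 * (n%:R * u)].
Proof.
move=> hu; have [r0 r1 nr m0 n0] := small_roundoff_bounds hu.
have [u0 _ _ _] := hu; rewrite /roundoff in r1 nr.
by split; apply: gamma_bounds; lra.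
Qed.

(** [r * d] is the [t] of the overview; [1 / 33] bounds it since [33^2 = 1089 <= 1100]. *)
Lemma sqrt_size_roundoff (R : realType) (u : R) m n : small_roundoff u m n ->
  let r := Num.sqrt n%:R in let d := Num.sqrt (roundoff u m n) in
  [/\ r ^+ 2 = n%:R, d ^+ 2 = roundoff u m n, 1 <= r, 0 < d & r * d <= 1 / 33].
Proof.
move=> hu r d; have [r0 _ _ _ _] := small_roundoff_bounds hu.
have [_ n0 _ nr] := hu.
have r2 : r ^+ 2 = n%:R by rewrite sqr_sqrtr.
have d2 : d ^+ 2 = roundoff u m n by rewrite sqr_sqrtr // ltW.
split=> //; first by rewrite -sqrtr1 ler_sqrt ?ltr0n // ler1n.
  by rewrite sqrtr_gt0.
apply: ler_of_sqr; first by lra.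
by rewrite exprMn r2 d2; lra.
Qed.

(** * The three steps of the algorithm *)

(** The last conclusion bounds [Y] in operator norm by [x] plus a term smaller than [K] by a factor
    of order [sqrt n]; the crude bound [|Y| <= 1.01 K] would cost a factor [sqrt n] in the
    residual. *)
Lemma shifted_step (R : realType) (u K : R) m n (X W : 'M[R]_(m, n)) Y :
    small_roundoff u m n -> 0 < K -> fnorm X <= K ->
    (forall z : 'cV_n,
       85 * Num.sqrt n%:R * roundoff u m n * K * fnorm z <= fnorm (X *m z)) ->
    fl_SCholeskyQR u (11 * roundoff u m n * K ^+ 2) X W Y ->
  [/\ fnorm Y <= 101 / 100 * K,
      fnorm (X - W *m Y) <= gamma u n * fnorm W * fnorm Y,
      fnorm W <= 101 / 100 * Num.sqrt n%:R,
      (forall z : 'cV_n, 18 * (Num.sqrt n%:R * Num.sqrt (roundoff u m n))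
        * fnorm z <= fnorm (W *m z)) /\
      opbound W (101 / 100) &
      forall x, 0 <= x -> opbound X x ->
        opbound Y (x + K / (9 * Num.sqrt n%:R))].
Proof.
move=> hu K0 XK lowX fl.
have [e0 e1 nue a0 b0] := small_roundoff_bounds hu.
have [[ga0 ga] [gb0 gb] [gn0 gn]] := small_roundoff_gamma hu.
have [r2 d2 r1 d0 rd] := sqrt_size_roundoff hu.
have [E YY [Yu EP YP FP]] := fl_SCholeskyQR_bounds ga0 gn0 gb0 fl.
have gram := gram_perturbation YY.
have eE : roundoff u m n = m%:R * u + n.+1%:R * u by [].
move: (gamma u m) (gamma u n.+1) (gamma u n) ga0 gb0 gn0 ga gb gn EP YP FP
  => ga gb gn ga0 gb0 gn0 gaP gbP gnP EP YP FP.
move: (m%:R * u) (n.+1%:R * u) (n%:R * u) a0 b0 eE gaP gbP gnP nue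
  => a b nu a0 b0 eE gaP gbP gnP nue.
clear fl YY hu.
move: (roundoff u m n) e0 e1 eE nue lowX d2 d0 rd gram YP
  => eps e0 e1 eE nue lowX d2 d0 rd gram YP.
set r := Num.sqrt n%:R in lowX r2 r1 rd *.
set d := Num.sqrt eps in d2 d0 rd *.
clearbody d; rewrite -r2 in YP.
have Y0 := fnorm_ge0 Y.
have K2 : 0 < K ^+ 2 by rewrite exprn_gt0.
have t2 : (r * d) ^+ 2 <= 1 / 33 * (1 / 33).
  have : 0 < r * d by rewrite mulr_gt0 // (lt_le_trans ltr01).
  by clear - rd; move: (r * d) rd => t t1 t0; nra.
have xK : fnorm X ^+ 2 <= K ^+ 2 by rewrite ler_pXn2r ?nnegrE ?fnorm_ge0 // ltW.
(* In the trace estimate the shift contributes [n s = 11 t^2 K^2 <= K^2 / 99] and the rounding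
   errors about [K^2 / 200] at most. *)
have y2 : fnorm Y ^+ 2 <= 101 / 100 * (101 / 100) * K ^+ 2.
  have h1 : gb * fnorm Y ^+ 2 <= 1 / 400 * fnorm Y ^+ 2.
    by rewrite ler_wpM2r ?sqr_ge0; clear - gbP e1 eE a0; lra.
  have h2 : ga * fnorm X ^+ 2 <= 1 / 400 * K ^+ 2.
    by apply: ler_pM (sqr_ge0 _) _ xK; clear - ga0 gaP e1 eE b0; lra.
  have := ler_wpM2r (ltW K2) t2; rewrite exprMn d2; clear - h1 h2 YP K2 xK.
  by lra.
have YK : fnorm Y <= 101 / 100 * K.
  by apply: ler_of_sqr; rewrite ?exprMn; clear - K0 y2; lra.
have e2 : fnorm E <= 26 / 25 * (eps * K ^+ 2).
  have h1 : ga * fnorm X ^+ 2 <= 101 / 100 * a * K ^+ 2.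
    exact: ler_pM ga0 (sqr_ge0 _) gaP xK.
  have h2 := ler_pM gb0 (sqr_ge0 _) gbP y2.
  have h3 : 0 <= a * K ^+ 2 by rewrite mulr_ge0 // ltW.
  have h4 : 0 <= b * K ^+ 2 by rewrite mulr_ge0 // ltW.
  by rewrite eE; clear - EP h1 h2 h3 h4; lra.
(* [q^2 = eps K^2 |z|^2] is the unit of the shift, which contributes [11 q^2], while [E] contributes
   at most [1.04 q^2]. The last bound is the hypothesis [lowX] with [eps = d^2]. *)
have gramz (z : 'cV_n) : exists q,
    [/\ q = d * K * fnorm z, 0 <= q,
      99 / 10 * q ^+ 2 <= fnorm (Y *m z) ^+ 2 - fnorm (X *m z) ^+ 2,
      fnorm (Y *m z) ^+ 2 - fnorm (X *m z) ^+ 2 <= 121 / 10 * q ^+ 2 &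
      85 * (r * d) * q <= fnorm (X *m z)].
  exists (d * K * fnorm z).
  have -> : (d * K * fnorm z) ^+ 2 = eps * K ^+ 2 * fnorm z ^+ 2.
    by rewrite !exprMn d2.
  have := gram z; have := ler_wpM2r (sqr_ge0 (fnorm z)) e2.
  have := lowX z; rewrite -d2 ler_norml => low ub /andP[g1 g2].
  split=> //.
  - by rewrite !mulr_ge0 ?fnorm_ge0 // ltW.
  - by clear - ub g1 g2; lra.
  - by clear - ub g1 g2; lra.
  - by clear - low; lra.
have dK : 0 < d * K by rewrite mulr_gt0.
have gnY : gn * fnorm Y <= 1 / 6 * d * (31 / 10 * (d * K)).
  have h := ler_pM gn0 Y0 gnP YK.
  have h1 : nu * K <= 1 / 2 * (d ^+ 2 * K).
    by rewrite mulrA ler_wpM2r ?(ltW K0) //; rewrite d2; clear - nue; lra.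
  have h2 : 0 < d ^+ 2 * K by rewrite mulr_gt0 // exprn_gt0.
  by clear - h h1 h2; lra.
(* [3.1 < sqrt 9.9] gives the bound on [Y^-1]. The factor [19 t] holds since
   [361 t^2 (|X z|^2 + 12.1 q^2) <= |X z|^2], from [t <= 1 / 33] and [|X z| >= 85 t q]. The relative
   error [d / 6] later lowers [19 t] to [18 t]. *)
have := @triangular_solve_bounds _ _ _ X W Y (19 * (r * d)) 1
  (31 / 10 * (d * K))^-1 gn (1 / 6 * d) Yu ler01.
case=> //.
- by rewrite invr_ge0; clear - dK; lra.
- move=> z; have [q [_ q0 g1 g2 g3]] := gramz z.
  apply: ler_of_sqr; first exact: fnorm_ge0.
  have rd0 : 0 <= r * d by rewrite mulr_ge0 ?(ltW d0) // (le_trans ler01).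
  have x2 : (85 * (r * d) * q) ^+ 2 <= fnorm (X *m z) ^+ 2.
    by rewrite ler_pXn2r ?nnegrE ?fnorm_ge0 // (mulr_ge0 _ q0) // mulr_ge0.
  have h1 := ler_wpM2r (sqr_ge0 (fnorm (X *m z))) t2.
  have h2 := ler_wpM2l (sqr_ge0 (r * d)) g2.
  have h3 := sqr_ge0 (fnorm (X *m z)).
  by clear - x2 h1 h2 h3; move: (r * d) x2 h1 h2 => t x2 h1 h2; lra.
- move=> z; have [q [_ q0 g1 _ _]] := gramz z.
  rewrite mul1r; apply: ler_of_sqr; first exact: fnorm_ge0.
  by have := sqr_ge0 q; clear - g1; lra.
- move=> z; have [q [qE q0 g1 _ _]] := gramz z.
  rewrite mulrC ler_pdivlMr; last by clear - dK; lra.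
  apply: ler_of_sqr; first exact: fnorm_ge0.
  have -> : fnorm z * (31 / 10 * (d * K)) = 31 / 10 * q by rewrite qE; ring.
  rewrite exprMn; have := sqr_ge0 q; have := sqr_ge0 (fnorm (X *m z)).
  by clear - g1; lra.
- by rewrite ler_pdivrMr //; clear - dK; lra.
rewrite mul1r -/r => _ _ Wr Wo Wlow.
have d1 : d <= 1 / 33.
  by apply: le_trans rd; rewrite ler_peMl // ltW.
have W0 := fnorm_ge0 W.
have Wr' : fnorm W <= 101 / 100 * r.
  have h : d * fnorm W <= 1 / 33 * fnorm W by rewrite ler_wpM2r.
  by clear - h Wr W0; lra.
have bW : 1 / 6 * d * fnorm W <= 1 / 5 * (r * d).
  have h := ler_wpM2l (ltW d0) Wr'.
  have h1 : 0 <= r * d by rewrite mulr_ge0 ?(ltW d0) // (le_trans ler01).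
  by clear - h h1; lra.
split=> //.
- split=> [z|].
    apply: le_trans (Wlow z); rewrite ler_wpM2r ?fnorm_ge0 //.
    have h1 : 0 <= r * d by rewrite mulr_ge0 ?(ltW d0) // (le_trans ler01).
    by clear - bW h1; lra.
  by apply: opbound_le _ Wo; clear - bW rd; lra.
(* Here [|Y z|^2 <= (x |z|)^2 + 12.1 q^2], and [r d <= 1 / 33] gives [q <= K |z| / (33 r)];
   [12.1 / 33^2 = 1 / 90] is below [(1 / 9)^2]. *)
move=> x x0 Xx z; have [q [qE q0 _ g2 _]] := gramz z.
have z0 := fnorm_ge0 z; have r0 : 0 < r by exact: lt_le_trans r1.
have Kr : K / (9 * r) = 1 / 9 * (K / r) by field; rewrite gt_eqF.
set p := K / r * fnorm z.
have p0 : 0 <= p by rewrite mulr_ge0 // divr_ge0 // ltW.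
have qp : q <= 1 / 33 * p.
  rewrite qE /p !mulrA ler_wpM2r // ler_pdivlMr //.
  have := ler_wpM2r (ltW K0) rd.
  by clear; lra.
have q2 : q ^+ 2 <= (1 / 33 * p) ^+ 2.
  by rewrite ler_pXn2r ?nnegrE // mulr_ge0 // divr_ge0.
have xz : fnorm (X *m z) ^+ 2 <= (x * fnorm z) ^+ 2.
  by rewrite ler_pXn2r ?nnegrE ?fnorm_ge0 ?mulr_ge0 //.
have xz0 : 0 <= x * fnorm z by rewrite mulr_ge0.
have -> : (x + K / (9 * r)) * fnorm z = x * fnorm z + 1 / 9 * p.
  by rewrite Kr /p; ring.
apply: ler_of_sqr; first by clear - xz0 p0; lra.
rewrite sqrrD; have := mulr_ge0 xz0 p0; have := sqr_ge0 p.
by clear - g2 q2 xz; lra.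
Qed.

(** Common to both unshifted steps, which enter with different bounds [c] for [|A| / sqrt n].
    [c <= 2] keeps the relative growth of the norm, about [1 / 400], inside the additive [1 / 100];
    [e] is [1.01 eps] times the square of the resulting bound on [|D|]. *)
Lemma unshifted_gram (R : realType) (u c : R) m n (A V : 'M[R]_(m, n)) D :
    small_roundoff u m n -> 1 <= c -> c <= 2 ->
    fnorm A <= c * Num.sqrt n%:R -> fl_SCholeskyQR u 0 A V D ->
  let t := Num.sqrt n%:R * Num.sqrt (roundoff u m n) in
  let e := 101 / 100 * (c + 1 / 100) ^+ 2 * t ^+ 2 in
  exists2 E : 'M_n, D^T *m D = A^T *m A + E &
  [/\ D \in unitmx, fnorm E <= e, fnorm D <= (c + 1 / 100) * Num.sqrt n%:R,
      fnorm (A - V *m D) <= gamma u n * fnorm V * fnorm D &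
      forall z : 'cV_n,
        fnorm (D *m z) ^+ 2 - fnorm (A *m z) ^+ 2 <= e * fnorm z ^+ 2 /\
        fnorm (A *m z) ^+ 2 - fnorm (D *m z) ^+ 2 <= e * fnorm z ^+ 2].
Proof.
move=> hu c1 c2 Ac fl t e.
have [e0 e1 nue a0 b0] := small_roundoff_bounds hu.
have [[ga0 gaP] [gb0 gbP] [gn0 _]] := small_roundoff_gamma hu.
have [r2 d2 r1 d0 _] := sqrt_size_roundoff hu.
have [E DD [Du EP DP FP]] := fl_SCholeskyQR_bounds ga0 gn0 gb0 fl.
have gram := gram_perturbation DD.
have eE : roundoff u m n = m%:R * u + n.+1%:R * u by [].
have {}e1 : m%:R * u + n.+1%:R * u <= 1 / 500 by rewrite -eE.
rewrite mul0r addr0 in DP.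
have c0 : 0 <= c by apply: le_trans c1.
have r0 : 0 <= Num.sqrt n%:R :> R by exact: sqrtr_ge0.
have tE : t ^+ 2 = (m%:R * u + n.+1%:R * u) * Num.sqrt n%:R ^+ 2.
  by rewrite exprMn d2 eE mulrC.
have A2 : fnorm A ^+ 2 <= (c * Num.sqrt n%:R) ^+ 2.
  by rewrite ler_pXn2r ?nnegrE ?fnorm_ge0 ?mulr_ge0.
have D2 : fnorm D ^+ 2 <= ((c + 1 / 100) * Num.sqrt n%:R) ^+ 2.
  have h1 : gamma u n.+1 * fnorm D ^+ 2 <= 1 / 400 * fnorm D ^+ 2.
    rewrite ler_wpM2r ?sqr_ge0 //.
    by clear - gbP e1 a0; lra.
  have h2 : gamma u m * fnorm A ^+ 2 <= 1 / 400 * (c * Num.sqrt n%:R) ^+ 2.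
    apply: ler_pM (sqr_ge0 _) _ A2 => //.
    by clear - gaP e1 b0; lra.
  have h3 : 0 <= (c - 1) * Num.sqrt n%:R ^+ 2.
    by rewrite mulr_ge0 ?subr_ge0 ?sqr_ge0.
  have h4 : 0 <= (2 - c) * ((c + 1) * Num.sqrt n%:R ^+ 2).
    by rewrite !mulr_ge0 ?subr_ge0 ?sqr_ge0 ?addr_ge0.
  rewrite exprMn in A2 h2 *; have h5 := sqr_ge0 (Num.sqrt n%:R : R).
  by clear - h1 h2 h3 h4 h5 A2 DP; lra.
have DF : fnorm D <= (c + 1 / 100) * Num.sqrt n%:R.
  by apply: ler_of_sqr => //; rewrite !mulr_ge0 ?addr_ge0 ?divr_ge0.
have Ee : fnorm E <= e.
  have h1 := ler_pM ga0 (sqr_ge0 _) gaP A2.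
  have h2 := ler_pM gb0 (sqr_ge0 _) gbP D2.
  have h3 : (c * Num.sqrt n%:R) ^+ 2 <= ((c + 1 / 100) * Num.sqrt n%:R) ^+ 2.
    rewrite ler_pXn2r ?nnegrE ?mulr_ge0 ?addr_ge0 ?divr_ge0 // ler_wpM2r //.
    by rewrite lerDl divr_ge0.
  have h4 := ler_wpM2l a0 h3.
  rewrite /e tE; rewrite !exprMn in h1 h2 h4.
  by clear - h1 h2 h4 EP; lra.
exists E; first by rewrite DD raddf0 addr0.
split=> // z; have := gram z; rewrite mul0r subr0 ler_norml => /andP[g1 g2].
have h := ler_wpM2r (sqr_ge0 (fnorm z)) Ee.
by clear - g1 g2 h; split; lra.
Qed.

(** The Gram error is at most about [1.06 t^2 |z|^2], while [|W z|^2 >= 324 t^2 |z|^2], so [|D z|^2]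
    and [|W z|^2] agree up to a relative [1 / 300]. As [D^-1] is bounded by [1 / (17 t)], the
    relative solve error is only [d / 30]. *)
Lemma second_step (R : realType) (u : R) m n (W V : 'M[R]_(m, n)) D :
    small_roundoff u m n -> fnorm W <= 101 / 100 * Num.sqrt n%:R ->
    (forall z : 'cV_n, 18 * (Num.sqrt n%:R * Num.sqrt (roundoff u m n))
       * fnorm z <= fnorm (W *m z)) ->
    opbound W (101 / 100) -> fl_SCholeskyQR u 0 W V D ->
  [/\ fnorm D <= 51 / 50 * Num.sqrt n%:R /\ opbound D (103 / 100),
      fnorm (W - V *m D) <= gamma u n * fnorm V * fnorm D,
      fnorm V <= 51 / 50 * Num.sqrt n%:R,
      (forall z : 'cV_n, 49 / 50 * fnorm z <= fnorm (V *m z)) &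
      opbound V (51 / 50)].
Proof.
move=> hu WF Wlow Wop fl.
have [e0 _ nue _ _] := small_roundoff_bounds hu.
have [_ _ [gn0 gnP]] := small_roundoff_gamma hu.
have [_ d2 r1 d0 rd] := sqrt_size_roundoff hu.
have c1 : 1 <= 101 / 100 :> R by lra.
have c2 : 101 / 100 <= 2 :> R by lra.
have [E _ [Du _ DF FP]] := unshifted_gram hu c1 c2 WF fl.
move: (gamma u n) (n%:R * u) gn0 gnP nue FP => gn nu gn0 gnP nue FP.
clear c1 c2 fl hu.
move: (roundoff u m n) e0 nue d2 d0 rd Wlow => eps e0 nue d2 d0 rd Wlow.
set r := Num.sqrt n%:R in WF DF r1 rd Wlow *.
set d := Num.sqrt eps in d2 d0 rd Wlow *; clearbody d.
have r0 : 0 < r by exact: lt_le_trans r1.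
have rd0 : 0 < r * d by rewrite mulr_gt0.
have DF' : fnorm D <= 51 / 50 * r by clear - DF; lra.
move=> gram; have V0 := fnorm_ge0 V.
have gramz (z : 'cV_n) : exists q,
    [/\ q = r * d * fnorm z, 0 <= q, 18 * q <= fnorm (W *m z),
      fnorm (D *m z) ^+ 2 <= 301 / 300 * fnorm (W *m z) ^+ 2 &
      299 / 300 * fnorm (W *m z) ^+ 2 <= fnorm (D *m z) ^+ 2].
  have q0 : 0 <= r * d * fnorm z by rewrite mulr_ge0 ?fnorm_ge0 // ltW.
  have h1 : 18 * (r * d * fnorm z) <= fnorm (W *m z).
    by rewrite mulrA.
  exists (r * d * fnorm z).
  have h2 : (18 * (r * d * fnorm z)) ^+ 2 <= fnorm (W *m z) ^+ 2.
    by rewrite ler_pXn2r ?nnegrE ?fnorm_ge0 // mulr_ge0.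
  have [] := gram z; rewrite -mulrA -exprMn => g1 g2.
  move: (r * d * fnorm z) q0 h1 h2 g1 g2 => q q0 h1 h2 g1 g2.
  have h3 := sqr_ge0 q.
  by split=> //; clear - h2 h3 g1 g2; lra.
have gnD : gn * fnorm D <= 1 / 30 * d * (17 * (r * d)).
  have h := ler_pM gn0 (fnorm_ge0 D) gnP DF'.
  have h1 : nu * r <= 1 / 2 * (d ^+ 2 * r).
    by rewrite mulrA ler_wpM2r ?(ltW r0) //; rewrite d2; clear - nue; lra.
  have h2 : 0 < d ^+ 2 * r by rewrite mulr_gt0 // exprn_gt0.
  by clear - h h1 h2; lra.
have := @triangular_solve_bounds _ _ _ W V D (99 / 100) (101 / 100)
  (17 * (r * d))^-1 gn (1 / 30 * d) Du.
case=> //.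
- by rewrite divr_ge0.
- by rewrite invr_ge0 mulr_ge0 // ltW.
- move=> z; have [q [_ _ _ g _]] := gramz z.
  apply: ler_of_sqr; first exact: fnorm_ge0.
  by rewrite exprMn; have := sqr_ge0 (fnorm (W *m z)); clear - g; lra.
- move=> z; have [q [_ _ _ _ g]] := gramz z.
  apply: ler_of_sqr; first by rewrite mulr_ge0 ?divr_ge0 ?fnorm_ge0.
  by rewrite exprMn; have := sqr_ge0 (fnorm (D *m z)); clear - g; lra.
- move=> z; have [q [qE q0 g1 _ g2]] := gramz z.
  rewrite mulrC ler_pdivlMr; last by rewrite mulr_gt0.
  apply: ler_of_sqr; first exact: fnorm_ge0.
  have -> : fnorm z * (17 * (r * d)) = 17 * q by rewrite qE; ring.
  have h : (18 * q) ^+ 2 <= fnorm (W *m z) ^+ 2.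
    by rewrite ler_pXn2r ?nnegrE ?fnorm_ge0 // mulr_ge0.
  by have := sqr_ge0 q; clear - g2 h; lra.
- by rewrite ler_pdivrMr // mulr_gt0.
rewrite -/r => _ _ Vr Vo Vlow.
have d1 : d <= 1 / 33 by apply: le_trans rd; rewrite ler_peMl // ltW.
have VF : fnorm V <= 51 / 50 * r.
  have h : d * fnorm V <= 1 / 33 * fnorm V by rewrite ler_wpM2r.
  by clear - h Vr V0 r0; lra.
have bV : 1 / 30 * d * fnorm V <= 1 / 100.
  have h := ler_wpM2l (ltW d0) VF.
  by clear - h rd rd0; lra.
split=> //.
- split=> // z; have [q [_ _ _ g _]] := gramz z.
  apply: ler_of_sqr; first by rewrite mulr_ge0 ?divr_ge0 ?fnorm_ge0.
  have h : fnorm (W *m z) ^+ 2 <= (101 / 100 * fnorm z) ^+ 2.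
    have z0 : 0 <= 101 / 100 * fnorm z by rewrite mulr_ge0 ?divr_ge0 ?fnorm_ge0.
    by rewrite ler_pXn2r ?nnegrE ?fnorm_ge0 ?Wop.
  rewrite exprMn in h *; have := sqr_ge0 (fnorm z).
  by clear - g h; lra.
- move=> z; apply: le_trans (Vlow z); rewrite ler_wpM2r ?fnorm_ge0 //.
  by clear - bV; lra.
- by apply: opbound_le _ Vo; clear - bV; lra.
Qed.

(** With [P = V J^-1] and [H] the solve error, [Q = P - H] and [Q^T Q - I = (P^T P - I) - P^T H -
    H^T P + H^T H]. The first term is at most [1.15 t^2] and [|H| <= 0.56 t^2], so the sum stays
    under [3 t^2]. *)
Lemma third_step (R : realType) (u : R) m n (V Q : 'M[R]_(m, n)) J :
    small_roundoff u m n -> fnorm V <= 51 / 50 * Num.sqrt n%:R ->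
    (forall z : 'cV_n, 49 / 50 * fnorm z <= fnorm (V *m z)) ->
    opbound V (51 / 50) -> fl_SCholeskyQR u 0 V Q J ->
  [/\ fnorm J <= 103 / 100 * Num.sqrt n%:R,
      fnorm (V - Q *m J) <= gamma u n * fnorm Q * fnorm J,
      fnorm Q <= 51 / 50 * Num.sqrt n%:R, opbound Q (51 / 50) &
      fnorm (Q^T *m Q - 1%:M) <= 3 * (n%:R * roundoff u m n)].
Proof.
move=> hu VF Vlow Vop fl.
have [e0 _ nue _ _] := small_roundoff_bounds hu.
have [_ _ [gn0 gnP]] := small_roundoff_gamma hu.
have [r2 d2 r1 d0 rd] := sqrt_size_roundoff hu.
have c1 : 1 <= 51 / 50 :> R by lra.
have c2 : 51 / 50 <= 2 :> R by lra.
have [E JJ [Ju EP JF FP gram]] := unshifted_gram hu c1 c2 VF fl.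
move: (gamma u n) (n%:R * u) gn0 gnP nue FP => gn nu gn0 gnP nue FP.
clear c1 c2 fl hu.
have <- : (Num.sqrt n%:R * Num.sqrt (roundoff u m n)) ^+ 2 =
  n%:R * roundoff u m n by rewrite exprMn r2 d2.
rewrite -{}d2 in nue; clear r2.
set r := Num.sqrt n%:R in VF JF EP gram r1 rd *.
set d := Num.sqrt (roundoff u m n) in d0 EP gram rd nue *; clearbody d.
clear e0 u.
have r0 : 0 < r by exact: lt_le_trans r1.
have rd0 : 0 < r * d by rewrite mulr_gt0.
have t2 : (r * d) ^+ 2 <= 1 / 1000.
  by clear - rd rd0; move: (r * d) rd rd0 => t t1 t0; nra.
have JF' : fnorm J <= 103 / 100 * r by clear - JF; lra.
have EP' : fnorm E <= 27 / 25 * (r * d) ^+ 2.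
  by have := sqr_ge0 (r * d); clear - EP; lra.
have Q0 := fnorm_ge0 Q.
have gramz (z : 'cV_n) :
    fnorm (J *m z) ^+ 2 - fnorm (V *m z) ^+ 2 <= 1 / 500 * fnorm z ^+ 2 /\
    fnorm (V *m z) ^+ 2 - fnorm (J *m z) ^+ 2 <= 1 / 500 * fnorm z ^+ 2.
  have [g1 g2] := gram z; have h := ler_wpM2r (sqr_ge0 (fnorm z)) t2.
  have h1 := sqr_ge0 (fnorm z).
  by clear - g1 g2 h h1; split; lra.
have lowz (z : 'cV_n) : 49 / 50 * (49 / 50) * fnorm z ^+ 2 <= fnorm (V *m z) ^+ 2.
  have := Vlow z; have := fnorm_ge0 z.
  move: (fnorm z) (fnorm (V *m z)) => p q p0 pq.
  have p1 : 0 <= 49 / 50 * p by rewrite mulr_ge0 ?divr_ge0.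
  have : (49 / 50 * p) ^+ 2 <= q ^+ 2.
    by rewrite ler_pXn2r ?nnegrE // (le_trans p1 pq).
  by clear; lra.
have gnJ : gn * fnorm J * (103 / 100) <= 27 / 50 * (r * d) * d.
  have h := ler_pM gn0 (fnorm_ge0 J) gnP JF'.
  have h1 : nu * r <= 1 / 2 * (d ^+ 2 * r).
    by rewrite mulrA ler_wpM2r ?(ltW r0) //; clear - nue; lra.
  have h2 : 0 < d ^+ 2 * r by rewrite mulr_gt0 // exprn_gt0.
  by clear - h h1 h2; lra.
(* [V] has singular values near 1, so [J^-1] is bounded by [1.03] and the relative solve error is of
   order [t d]; multiplied by [|Q| <= 1.02 r] it becomes of order [t^2]. *)
have := @triangular_solve_bounds _ _ _ V Q J 0 (101 / 100)
  (103 / 100) gn (27 / 50 * (r * d) * d) Ju.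
case=> //.
- by rewrite divr_ge0.
- by rewrite divr_ge0.
- by move=> z; rewrite mul0r fnorm_ge0.
- move=> z; have [g1 g2] := gramz z; have h := lowz z.
  apply: ler_of_sqr; first by rewrite mulr_ge0 ?divr_ge0 ?fnorm_ge0.
  by rewrite exprMn; have := sqr_ge0 (fnorm z); clear - g1 g2 h; lra.
- move=> z; have [g1 g2] := gramz z; have h := lowz z.
  apply: ler_of_sqr; first by rewrite mulr_ge0 ?divr_ge0 ?fnorm_ge0.
  by rewrite exprMn; have := sqr_ge0 (fnorm z); clear - g1 g2 h; lra.
rewrite -/r; set H := _ *m invmx J; set P := V *m invmx J.
move=> Hb [Pop Jop] Qr Qo _.
have d1 : d <= r * d by rewrite ler_peMl // ltW.
have QF : fnorm Q <= 51 / 50 * r.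
  have h : r * d * d * fnorm Q <= 1 / 1000 * fnorm Q.
    rewrite ler_wpM2r // (le_trans _ t2) // expr2 ler_wpM2l // ltW //.
  by clear - h Qr Q0 r0; lra.
have bQ : 27 / 50 * (r * d) * d * fnorm Q <= 14 / 25 * (r * d) ^+ 2.
  have h := ler_wpM2l (ltW (mulr_gt0 rd0 d0)) QF.
  by have := sqr_ge0 (r * d); clear - h; lra.
split=> //.
- by apply: opbound_le _ Qo; clear - bQ t2; lra.
have QE : Q = P - H by rewrite /P /H mulmxBl (mulmxK Ju) subKr.
(* Since [J^T J = V^T V + E], [P] fails to be orthonormal exactly by [J^-T E J^-1]. *)
have PP : P^T *m P = 1%:M - (invmx J)^T *m E *m invmx J.
  have -> : P^T *m P = (invmx J)^T *m (V^T *m V) *m invmx J.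
    by rewrite /P trmx_mul !mulmxA.
  rewrite (_ : V^T *m V = J^T *m J - E); last by rewrite JJ addrK.
  rewrite mulmxBr mulmxBl; congr (_ - _).
  by rewrite mulmxA -trmx_mul mulmxV // trmx1 mul1mx mulmxV.
have -> : Q^T *m Q - 1%:M =
    - ((invmx J)^T *m E *m invmx J) - P^T *m H - (H^T *m P - H^T *m H).
  rewrite QE [(P - H)^T]linearB /= mulmxBl !mulmxBr PP.
  rewrite addrAC; congr (_ - _); rewrite addrAC; congr (_ - _).
  by rewrite addrAC subrr sub0r.
have y0 : 0 <= 103 / 100 :> R by rewrite divr_ge0.
have p0 : 0 <= 101 / 100 :> R by rewrite divr_ge0.
have n1 : fnorm (- ((invmx J)^T *m E *m invmx J))
    <= 103 / 100 * fnorm E * (103 / 100).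
  rewrite fnormN; apply: le_trans (opbound_mulmxr _ y0 Jop) _.
  by rewrite ler_wpM2r // opbound_mulmx //; exact: opboundT.
have n2 : fnorm (P^T *m H) <= 101 / 100 * fnorm H.
  by apply: opbound_mulmx => //; exact: opboundT.
have n3 : fnorm (H^T *m P) <= fnorm H * (101 / 100).
  by apply: le_trans (opbound_mulmxr _ p0 Pop) _; rewrite fnormT.
have n4 : fnorm (H^T *m H) <= fnorm H * fnorm H.
  by apply: le_trans (fnormM _ _) _; rewrite fnormT.
have HF := le_trans Hb bQ.
have HH : fnorm H * fnorm H <= fnorm H * (14 / 25 * (r * d) ^+ 2).
  by rewrite ler_wpM2l ?fnorm_ge0.
have HH2 : fnorm H * (r * d) ^+ 2 <= fnorm H * (1 / 1000).
  by rewrite ler_wpM2l ?fnorm_ge0.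
apply: le_trans (fnormB _ _) _; have n5 := fnormB (H^T *m P) (H^T *m H).
have n6 := fnormB (- ((invmx J)^T *m E *m invmx J)) (P^T *m H).
have := sqr_ge0 (r * d); have := fnorm_ge0 H.
by clear - n1 n2 n3 n4 n5 n6 EP' HF HH HH2; lra.
Qed.

(** * The residual *)

(** Each of the five backward errors is taken in Frobenius norm and its outer factors in operator
    norm. Those of the second and third solve carry [g r^2] and meet [Y] or [N], whose operator
    norms are at most about [x + K / (9 r)]; hence the two scales [g r K] and [g r (r x)]. *)
Lemma residual_bound (R : realType) (g r K x : R) m n
    (X W V Q : 'M[R]_(m, n)) (Y D J N Rf : 'M_n) :
    0 <= g -> 1 <= r -> g * r ^+ 2 <= 1 / 500 -> 0 <= K -> 0 <= x ->
    fnorm (X - W *m Y) <= g * fnorm W * fnorm Y ->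
    fnorm (W - V *m D) <= g * fnorm V * fnorm D ->
    fnorm (V - Q *m J) <= g * fnorm Q * fnorm J ->
    fnorm (D *m Y - N) <= g * fnorm D * fnorm Y ->
    fnorm (J *m N - Rf) <= g * fnorm J * fnorm N ->
    fnorm Y <= 101 / 100 * K -> opbound Y (x + K / (9 * r)) ->
    fnorm W <= 101 / 100 * r ->
    fnorm D <= 51 / 50 * r -> opbound D (103 / 100) ->
    fnorm V <= 51 / 50 * r -> opbound V (51 / 50) ->
    fnorm J <= 103 / 100 * r ->
    fnorm Q <= 51 / 50 * r -> opbound Q (51 / 50) ->
  fnorm (Q *m Rf - X) <= 7 / 2 * (g * r * K) + 3 * (g * r * (r * x)).
Proof.
move=> g0 r1 gr2 K0 x0 F1 F2 F3 F4 F5 YK Yop WF DF Dop VF Vop JF QF Qop.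
have r0 : 0 < r by exact: lt_le_trans r1.
have gr0 : 0 <= g * r by rewrite mulr_ge0 // ltW.
have y0 : 0 <= x + K / (9 * r).
  by rewrite addr_ge0 // divr_ge0 // mulr_ge0 // ltW.
(* The summand [K / (9 r)] cancels one [r], so it adds only [1 / 9] of the scale [g r K]. *)
have yE : g * r ^+ 2 * (x + K / (9 * r)) = g * r * (r * x) + 1 / 9 * (g * r * K).
  by field; rewrite gt_eqF.
set y := x + _ in Yop y0 yE.
have P0 : 0 <= g * r * K by rewrite mulr_ge0.
have S0 : 0 <= g * r * (r * x) by rewrite !mulr_ge0 // ltW.
have c1 : 0 <= 103 / 100 :> R by rewrite divr_ge0.
have c2 : 0 <= 51 / 50 :> R by rewrite divr_ge0.
have gprod (a b s t : R) : 0 <= a -> 0 <= b -> a <= s -> b <= t ->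
    g * a * b <= g * (s * t).
  by move=> a0 b0 as_ bt; rewrite -mulrA ler_wpM2l // ler_pM.
have f1 := le_trans F1 (gprod _ _ _ _ (fnorm_ge0 W) (fnorm_ge0 Y) WF YK).
have f2 := le_trans F2 (gprod _ _ _ _ (fnorm_ge0 V) (fnorm_ge0 D) VF DF).
have f3 := le_trans F3 (gprod _ _ _ _ (fnorm_ge0 Q) (fnorm_ge0 J) QF JF).
have f4 := le_trans F4 (gprod _ _ _ _ (fnorm_ge0 D) (fnorm_ge0 Y) DF YK).
have NE : N = D *m Y - (D *m Y - N) by rewrite subKr.
have Nop : opbound N (103 / 100 * y + 104 / 100 * (g * r * K)).
  rewrite NE; apply: opboundB; first exact: opboundM.
  apply: opbound_le _ (opbound_fnorm _); clear - f4 P0; lra.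
have gr1 : g * r * K <= 1 / 500 * K.
  rewrite ler_wpM2r // (le_trans _ gr2) // expr2 mulrA ler_peMr //.
have NF : fnorm N <= 105 / 100 * K.
  rewrite NE; apply: le_trans (fnormB _ _) _.
  have h := opbound_mulmx Y c1 Dop.
  by clear - h f4 gr1 YK K0; lra.
have f5 := le_trans F5 (gprod _ _ _ _ (fnorm_ge0 J) (fnorm_ge0 N) JF NF).
have N0 : 0 <= 103 / 100 * y + 104 / 100 * (g * r * K).
  by rewrite addr_ge0 // mulr_ge0 // divr_ge0.
have t2 : fnorm ((W - V *m D) *m Y) <= g * (51 / 50 * r * (51 / 50 * r)) * y.
  by apply: le_trans (opbound_mulmxr _ y0 Yop) _; rewrite ler_wpM2r.
have t3 : fnorm (V *m (D *m Y - N))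
    <= 51 / 50 * (g * (51 / 50 * r * (101 / 100 * K))).
  by apply: le_trans (opbound_mulmx _ c2 Vop) _; rewrite ler_wpM2l.
have t4 : fnorm ((V - Q *m J) *m N) <= g * (51 / 50 * r * (103 / 100 * r)) *
    (103 / 100 * y + 104 / 100 * (g * r * K)).
  by apply: le_trans (opbound_mulmxr _ N0 Nop) _; rewrite ler_wpM2r.
have t5 : fnorm (Q *m (J *m N - Rf))
    <= 51 / 50 * (g * (103 / 100 * r * (105 / 100 * K))).
  by apply: le_trans (opbound_mulmx _ c2 Qop) _; rewrite ler_wpM2l.
have t6 : g * r ^+ 2 * (g * r * K) <= 1 / 500 * (g * r * K).
  by rewrite ler_wpM2r.
(* Telescoping: [W Y], [V D Y], [V N] and [Q J N] each occur twice with opposite signs. *)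
have -> : Q *m Rf - X = - (X - W *m Y) - (W - V *m D) *m Y
    - V *m (D *m Y - N) - (V - Q *m J) *m N - Q *m (J *m N - Rf).
  rewrite !mulmxBl !mulmxBr !mulmxA.
  move: (W *m Y) (V *m D *m Y) (V *m N) (Q *m J *m N) (Q *m Rf) => a b c d e.
  by apply/matrixP => i j; rewrite !mxE; ring.
apply: le_trans (fnormB _ _) _.
apply: le_trans (lerD (fnormB _ _) (lexx _)) _.
apply: le_trans (lerD (lerD (fnormB _ _) (lexx _)) (lexx _)) _.
apply: le_trans (lerD (lerD (lerD (fnormB _ _) (lexx _)) (lexx _)) (lexx _)) _.
rewrite fnormN; move: y yE t2 t4 {Yop Nop y0 N0} => y yE t2 t4.
by clear - f1 t2 t3 t4 t5 t6 yE P0 S0; lra.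
Qed.

(** * From the hypotheses on [X] to the final bounds *)

(** Only the nonzero entries contribute, each by at most the square of the largest. *)
Lemma fnorm_le_nnz (R : realType) m n (X : 'M[R]_(m, n)) :
  fnorm X <= maxabs X * Num.sqrt (nnz X)%:R.
Proof.
have c0 : 0 <= maxabs X by rewrite /maxabs; apply: bigmax_ge_id.
apply: ler_of_sqr; first by rewrite mulr_ge0 ?sqrtr_ge0.
rewrite fnorm_sqr exprMn sqr_sqrtr ?ler0n // pair_big /= mulr_natr -sumr_const.
rewrite [leRHS]big_mkcond /=; apply: ler_sum => ij _.
have [X0|] := ifPn; last by rewrite inE negbK => /eqP ->; rewrite expr0n.
rewrite -real_normK ?num_real // ler_pXn2r ?nnegrE //.
exact: (le_bigmax _ (fun ij : 'I_m * 'I_n => `|X ij.1 ij.2|)).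
Qed.

Theorem theorem1p5 (R : realType) (m n : nat) (X : 'M[R]_(m, n)) :
  (1 <= n)%N -> (n <= m)%N -> \rank X = n ->
  let u : R := 2 ^- 53 in
  let k : R := (nnz X)%:R in
  let c : R := maxabs X in
  let l : R := c * Num.sqrt k / specnorm X in
  let s : R := 11 * (m%:R * u + n.+1%:R * u) * k * c ^+ 2 in
  m%:R * n%:R * u <= 1 / 64 ->
  n%:R * n.+1%:R * u <= 1 / 64 ->
  kappa2 X <= 1 / (85 * l * Num.sqrt n%:R * (m%:R * u + n.+1%:R * u)) ->
  s <= 1 / (100 * n%:R) * k * c ^+ 2 ->
  forall (Q : 'M[R]_(m, n)) (Rf : 'M[R]_n),
    fl_SCholeskyQR3 u s X Q Rf ->
    fnorm (Q^T *m Q - 1%:M)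
      <= 6 * (m%:R * n%:R * u + n%:R * n.+1%:R * u) /\
    fnorm (Q *m Rf - X)
      <= (358 / 100 * l + 545 / 100 * Num.sqrt n%:R)
         * n%:R * Num.sqrt n%:R * u * specnorm X.
Proof.
move=> n0 nm rX u k c l s _ _ kappaX sle Q Rf [W [V [Y [D [J [N]]]]]].
have u0 : 0 < u by rewrite invr_gt0 exprn_gt0.
clearbody u; pose K := c * Num.sqrt k.
have K2 : K ^+ 2 = k * c ^+ 2 by rewrite exprMn sqr_sqrtr ?ler0n // mulrC.
have sE : s = 11 * roundoff u m n * K ^+ 2 by rewrite /s K2 mulrA.
have XK : fnorm X <= K by exact: fnorm_le_nnz.
have X0 : X != 0.
  by apply: contraTneq n0 => X0; rewrite -rX X0 mxrank0.
have K0 : 0 < K.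
  by apply: lt_le_trans XK; rewrite lt_def fnorm_eq0 X0 fnorm_ge0.
have nR : 0 < n%:R :> R by rewrite ltr0n.
have hu : small_roundoff u m n.
  split=> //; move: sle; rewrite sE -(mulrA _ k) -K2 ler_pM2r ?exprn_gt0 //.
  rewrite ler_pdivlMr; last by rewrite mulr_gt0.
  by move: (roundoff u m n) => eps; lra.
have [eps0 _ nue _ _] := small_roundoff_bounds hu.
have [_ _ [g0 gP]] := small_roundoff_gamma hu.
have [r2 _ r1 _ _] := sqrt_size_roundoff hu.
have sigma0 := sigma_min_gt0 n0 rX.
have Xop := opbound_specnorm X n0.
have x0 : 0 < specnorm X.
  have e0 : 0 < fnorm (delta_mx (Ordinal n0) 0 : 'cV[R]_n).
    rewrite lt_def fnorm_ge0 fnorm_eq0 andbT.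
    apply/eqP => /matrixP/(_ (Ordinal n0) 0)/eqP.
    by rewrite !mxE !eqxx oner_eq0.
  rewrite -(pmulr_lgt0 _ e0); apply: lt_le_trans (Xop _).
  by apply: lt_le_trans (sigma_min_le X _ n0); rewrite mulr_gt0.
have lx : l * specnorm X = K by rewrite /l -/K divfK // gt_eqF.
have l0 : 0 < l by exact: divr_gt0 K0 x0.
have r0 : 0 < Num.sqrt n%:R :> R by exact: lt_le_trans r1.
(* Clearing denominators in the condition number bound gives [85 l sqrt n eps |X|_2 <= sigma_min X],
   and [l |X|_2 = K]. *)
have lowX (z : 'cV_n) :
    85 * Num.sqrt n%:R * roundoff u m n * K * fnorm z <= fnorm (X *m z).
  apply: le_trans (sigma_min_le X z n0); rewrite ler_wpM2r ?fnorm_ge0 //.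
  move: kappaX; rewrite /kappa2 ler_pdivrMr // mulrAC mul1r ler_pdivlMr.
    by rewrite -lx /roundoff; lra.
  by apply: mulr_gt0 (mulr_gt0 (mulr_gt0 _ l0) r0) eps0; rewrite ltr0n.
rewrite sE => -[flX flW flV flN flR].
have [YK FY WF [Wlow Wop] Yop] := shifted_step hu K0 XK lowX flX.
have [[DF Dop] FD VF Vlow Vop] := second_step hu WF Wlow Wop flW.
have [JF FJ QF Qop orthQ] := third_step hu VF Vlow Vop flV.
have FN := fl_mul_bound g0 flN; have FR := fl_mul_bound g0 flR.
have nr0 : 0 < n%:R * roundoff u m n by rewrite mulr_gt0.
split.
  apply: le_trans orthQ _.
  have -> : m%:R * n%:R * u + n%:R * n.+1%:R * u = n%:R * roundoff u m n.
    by rewrite /roundoff; ring.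
  by clear - nr0; lra.
have gr2 : gamma u n * Num.sqrt n%:R ^+ 2 <= 1 / 500.
  have [_ _ _ nr] := hu.
  have h1 := ler_wpM2r (ltW nR) gP; have h2 := ler_wpM2r (ltW nR) nue.
  by rewrite r2; clear - h1 h2 nr; lra.
(* With [g <= 1.01 n u] the two scales become [l n sqrt n u |X|_2] and [n^2 u |X|_2], with
   coefficients [3.535] and [3.03]. *)
apply: le_trans (residual_bound g0 r1 gr2 (ltW K0) (ltW x0) FY FD FJ FN FR
  YK (Yop _ (ltW x0) Xop) WF DF Dop VF Vop JF QF Qop) _.
have rK0 : 0 < Num.sqrt n%:R * K by rewrite mulr_gt0.
have rx0 : 0 < Num.sqrt n%:R * (Num.sqrt n%:R * specnorm X).
  by rewrite !mulr_gt0.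
have h1 := ler_wpM2r (ltW rK0) gP; have h2 := ler_wpM2r (ltW rx0) gP.
have h3 : 0 <= n%:R * u * (Num.sqrt n%:R * K).
  by rewrite mulr_ge0 ?(ltW rK0) // mulr_ge0 // ltW.
have h4 : 0 <= n%:R * u * (Num.sqrt n%:R * (Num.sqrt n%:R * specnorm X)).
  by rewrite mulr_ge0 ?(ltW rx0) // mulr_ge0 // ltW.
rewrite -lx in h1 h3 *.
by clear - h1 h2 h3 h4; lra.
Qed.
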